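(* Let $\mathcal{X}=(X,\omega_X,\nu)$ and $\mathcal{Y}=(Y,\omega_Y,\mu)$ be two finite measure networks with $X=\{x_1,\dots,x_n\}\subset\mathbb{R}^d$, $Y=\{y_1,\dots,y_m\}\subset\mathbb{R}^d$, $\nu=\sum_{i=1}^n a_i\delta_{x_i}$ and $\mu=\sum_{j=1}^m b_j\delta_{y_j}$, where $a_i>0$ for all $i$. Let $\alpha\in[0,1]$, let $\gamma\in U(a,b)$ be an $\alpha$-Fused 2-Gromov-Wasserstein optimal coupling of $\mathcal{X}$ and $\mathcal{Y}$, let $T(x_i)=\sum_{j}\frac{\gamma_{ij}}{a_i}y_j$, let $\mathcal{T}=(T(X),\omega_C,T_\#\nu)$ be the FGW barycentric projection of $\mathcal{Y}$ with respect to $\mathcal{X}$ induced by $\gamma$, and let $\pi=(T,\mathrm{id}_Y)_\#\gamma$ be the coupling of $\mathcal{T}$ and $\mathcal{Y}$ obtained from $\gamma$ by the map $(x,y)\mapsto(T(x),y)$. Then $$FGW_{2,\alpha}^2(\mathcal{X},\mathcal{Y})=FGW_{2,\alpha}^2(\mathcal{X},\mathcal{T})+C^{\alpha}_{FGW}(\pi).$$ Consequently, if $\mathcal{Y}^1,\dots,\mathcal{Y}^N$ are finite measure networks with nodes in $\mathbb{R}^d$, and for each $\ell$ the objects $\gamma^\ell$, $\mathcal{T}^\ell$, $\pi^\ell$ are obtained from the pair $(\mathcal{X},\mathcal{Y}^\ell)$ in the same way as $\gamma,\mathcal{T},\pi$ are from $(\mathcal{X},\mathcal{Y})$, then $$\frac1N\sum_{\ell=1}^N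 FGW_{2,\alpha}^2(\mathcal{X},\mathcal{Y}^\ell)=\frac1N\sum_{\ell=1}^N FGW_{2,\alpha}^2(\mathcal{X},\mathcal{T}^\ell)+\frac1N\sum_{\ell=1}^N C^{\alpha}_{FGW}(\pi^\ell).$$
   Context: A finite measure network with nodes in $\mathbb{R}^d$ is a triple $(X,\omega_X,\nu)$ consisting of nodes $x_1,\dots,x_n\in\mathbb{R}^d$, a probability measure $\nu=\sum_i a_i\delta_{x_i}$, and an arbitrary real-valued function $\omega_X$ on pairs of nodes (no symmetry or metric property is assumed). For weight vectors $a\in\mathbb{R}^n$, $b\in\mathbb{R}^m$ (nonnegative entries summing to 1), couplings are identified with matrices in $$U(a,b)=\Big\{\gamma\in\mathbb{R}^{n\times m}:\gamma_{ij}\ge0,\ \sum_{i}\gamma_{ij}=b_j,\ \sum_j\gamma_{ij}=a_i\ \ \forall i,j\Big\}.$$ Transport costs. For networks $\mathcal{X}=(X,\omega_X,\nu)$, $\mathcal{Y}=(Y,\omega_Y,\mu)$ with nodes in $\mathbb{R}^d$ and weights $a,b$, and for a coupling $\gamma\in U(a,b)$, $$C_W(\gamma)=\sum_{i,j}\gamma_{ij}\|x_i-y_j\|^2,\qquad C_{GW}(\gamma)=\sum_{i,j,k,l}\gamma_{ij}\gamma_{kl}\big(\omega_X(x_i,x_k)-\omega_Y(y_j,y_l)\big)^2,$$ $$C^\alpha_{FGW}(\gamma)=\alpha\, C_W(\gamma)+(1-\alpha)\,C_{GW}(\gamma),$$ where $\|\cdot\|$ is the Euclidean norm. The cost of a coupling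 is always computed with respect to the two networks it couples. The squared $\alpha$-Fused 2-Gromov-Wasserstein distance is $FGW_{2,\alpha}^2(\mathcal{X},\mathcal{Y})=\min_{\gamma\in U(a,b)}C^\alpha_{FGW}(\gamma)$; a minimizer is called an $\alpha$-Fused 2-Gromov-Wasserstein optimal coupling. FGW barycentric projection. Given an $\alpha$-Fused 2-Gromov-Wasserstein optimal coupling $\gamma$ of $\mathcal{X}$ and $\mathcal{Y}$, put $T(x_i)=\sum_j\frac{\gamma_{ij}}{a_i}y_j$, $B_{jl}=\omega_Y(y_j,y_l)$ and $C_{ik}=\sum_{j,l}\frac{\gamma_{ij}}{a_i}\frac{\gamma_{kl}}{a_k}B_{jl}$. The FGW barycentric projection of $\mathcal{Y}$ with respect to $\mathcal{X}$ is $\mathcal{T}=(T(X),\omega_C,T_\#\nu)$, where $T(X)$ is the list (an $n\times d$ matrix) of nodes with $i$-th node $T(x_i)$, the value of $\omega_C$ on the $(i,k)$-th pair of nodes is $C_{ik}$, and $T_\#\nu=\sum_i a_i\delta_{T(x_i)}$. Nodes of $\mathcal{T}$ are indexed by $i=1,\dots,n$ (so nodes with different indices are kept separate even if their positions $T(x_i)$ coincide), and couplings involving $\mathcal{T}$ are matrices indexed accordingly, with weight vector $a$. In particular $\pi$ is given by the matrix $\gamma$, regarded as a coupling of $\mathcal{T}$ and $\mathcal{Y}$, so that $$C^\alpha_{FGW}(\pi)=\alpha\sum_{i,j}\gamma_{ij}\|T(x_i)-y_j\|^2+(1-\alpha)\sum_{i,j,k,l}\gamma_{ij}\gamma_{kl}(C_{ik}-B_{jl})^2.$$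 *)

(* Defs.v *)
From HB Require Import structures.
From mathcomp Require Import all_boot all_order all_algebra.
From mathcomp Require Import all_classical all_reals topology normedtype derive.

Set Implicit Arguments.
Unset Strict Implicit.
Unset Printing Implicit Defensive.

Import Order.TTheory GRing.Theory Num.Theory.
Import numFieldNormedType.Exports.

Local Open Scope classical_set_scope.
Local Open Scope ring_scope.

(* The network function is indexed by pairs of node indices, so that nodes with
   different indices stay separate even if their positions coincide. *)
Record network (R : realType) (d n : nat) := Network {
  node : 'I_n -> 'rV[R]_d;
  weight : 'I_n -> R;
  omega : 'I_n -> 'I_n -> R;
  weight_ge0 : forall i, 0 <= weight i;
  weight_sum1 : \sum_(i < n) weight i = 1
}.

(* The library norm `|v| on row vectors is the sup norm, not this one. *)
Definition euclidean_norm (R : realType) (d : nat) (v : 'rV[R]_d) : R :=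
  Num.sqrt (\sum_(k < d) v ord0 k ^+ 2).

Definition couplings (R : realType) (n m : nat) (a : 'I_n -> R) (b : 'I_m -> R)
    : set 'M[R]_(n, m) :=
  [set gamma | [/\ forall i j, 0 <= gamma i j,
                   forall j, \sum_(i < n) gamma i j = b j &
                   forall i, \sum_(j < m) gamma i j = a i]].

Definition cost_W (R : realType) (d n m : nat)
    (X : network R d n) (Y : network R d m) (gamma : 'M[R]_(n, m)) : R :=
  \sum_(i < n) \sum_(j < m)
    gamma i j * euclidean_norm (node X i - node Y j) ^+ 2.

Definition cost_GW (R : realType) (d n m : nat)
    (X : network R d n) (Y : network R d m) (gamma : 'M[R]_(n, m)) : R :=
  \sum_(i < n) \sum_(j < m) \sum_(k < n) \sum_(l < m)
    gamma i j * gamma k l * (omega X i k - omega Y j l) ^+ 2.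

Definition cost_FGW (R : realType) (d n m : nat) (alpha : R)
    (X : network R d n) (Y : network R d m) (gamma : 'M[R]_(n, m)) : R :=
  alpha * cost_W X Y gamma + (1 - alpha) * cost_GW X Y gamma.

(* The infimum is a minimum, see FGW2_attained. *)
Definition FGW2 (R : realType) (d n m : nat) (alpha : R)
    (X : network R d n) (Y : network R d m) : R :=
  inf [set cost_FGW alpha X Y gamma
      | gamma in couplings (weight X) (weight Y)].

Definition FGW_optimal (R : realType) (d n m : nat) (alpha : R)
    (X : network R d n) (Y : network R d m) (gamma : 'M[R]_(n, m)) : Prop :=
  couplings (weight X) (weight Y) gamma /\
  forall gamma', couplings (weight X) (weight Y) gamma' ->
    cost_FGW alpha X Y gamma <= cost_FGW alpha X Y gamma'.

Definition barycentric_node (R : realType) (d n m : nat)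
    (X : network R d n) (Y : network R d m) (gamma : 'M[R]_(n, m))
    (i : 'I_n) : 'rV[R]_d :=
  \sum_(j < m) (gamma i j / weight X i) *: node Y j.

Definition barycentric_omega (R : realType) (d n m : nat)
    (X : network R d n) (Y : network R d m) (gamma : 'M[R]_(n, m))
    (i k : 'I_n) : R :=
  \sum_(j < m) \sum_(l < m)
    (gamma i j / weight X i) * (gamma k l / weight X k) * omega Y j l.

Definition barycentric_projection (R : realType) (d n m : nat)
    (X : network R d n) (Y : network R d m) (gamma : 'M[R]_(n, m))
    : network R d n :=
  Network (barycentric_node X Y gamma) (barycentric_omega X Y gamma)
          (weight_ge0 X) (weight_sum1 X).

Lemma FGW_optimalE (R : realType) (d n m : nat) (alpha : R)
    (X : network R d n) (Y : network R d m) (gamma : 'M[R]_(n, m)) :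
  FGW_optimal alpha X Y gamma -> FGW2 alpha X Y = cost_FGW alpha X Y gamma.
Proof.
move=> [Ug ming]; apply/eqP; rewrite eq_le; apply/andP; split.
  apply: ge_inf; last by exists gamma.
  by exists (cost_FGW alpha X Y gamma) => _ [g Uh <-]; exact: ming.
apply: lb_le_inf; first by exists (cost_FGW alpha X Y gamma), gamma.
by move=> _ [g Uh <-]; exact: ming.
Qed.

Lemma FGW_optimal_exists (R : realType) (d n m : nat) (alpha : R)
    (X : network R d n) (Y : network R d m) :
  exists gamma, FGW_optimal alpha X Y gamma.
Proof.
pose A : set 'rV[R]_(n * m) :=
  [set v | couplings (weight X) (weight Y) (vec_mx v)].
pose f (v : 'rV[R]_(n * m)) : R := cost_FGW alpha X Y (vec_mx v).
have cE i j : continuous (fun v : 'rV[R]_(n * m) => vec_mx v i j : R).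
  have -> : (fun v : 'rV[R]_(n * m) => vec_mx v i j : R) =
            (fun v : 'rV[R]_(n * m) => v ord0 (mxvec_index i j)).
    by apply/funext => v; rewrite mxE.
  exact: coord_continuous.
have cS (I : finType) (F : I -> 'rV[R]_(n * m) -> R) :
    (forall i, continuous (F i)) -> continuous (fun v => \sum_i F i v).
  by move=> cF; apply: continuous_big => //; exact: add_continuous.
have cM (F G : 'rV[R]_(n * m) -> R) : continuous F -> continuous G ->
    continuous (fun v => F v * G v).
  by move=> cF cG v; exact: (cvgM (cF v) (cG v)).
have cC (c : R) : continuous (fun _ : 'rV[R]_(n * m) => c).
  exact: cst_continuous.
have A0 : A !=set0.
  exists (mxvec (\matrix_(i, j) (weight X i * weight Y j))).
  rewrite /A /= mxvecK; split=> [i j|j|i].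
  - by rewrite mxE mulr_ge0 ?weight_ge0.
  - by under eq_bigr do rewrite mxE; rewrite -mulr_suml weight_sum1 mul1r.
  - by under eq_bigr do rewrite mxE; rewrite -mulr_sumr weight_sum1 mulr1.
have clA : closed A.
  have -> : A = (\bigcap_(p in [set: 'I_n * 'I_m])
                   (fun v => vec_mx v p.1 p.2) @^-1` [set x | 0 <= x]) `&`
      ((\bigcap_(j in [set: 'I_m])
          (fun v => \sum_i vec_mx v i j) @^-1` [set x | x = weight Y j]) `&`
       (\bigcap_(i in [set: 'I_n])
          (fun v => \sum_j vec_mx v i j) @^-1` [set x | x = weight X i])).
    apply/seteqP; split=> v.
      by case=> g0 gb ga; split=> [[i j] _|]; [exact: g0|split=> k _ //=].
    by case=> g0 [gb ga]; split=> [i j|j|i]; [exact: (g0 (i, j))|exact: gb|exact: ga].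
  apply: closedI; [|apply: closedI]; apply: closed_bigI => p _;
    apply: preimage_closed.
  - by move=> v _; exact: cE.
  - exact: closed_ge.
  - by move=> v _; apply: cS => i; exact: cE.
  - exact: closed_eq.
  - by move=> v _; apply: cS => j; exact: cE.
  - exact: closed_eq.
have cA : compact A.
  apply: (subclosed_compact clA (@rV_compact R _ (fun=> `[0, 1]%classic) _)).
    by move=> _; exact: segment_compact.
  move=> v [g0 _ ga] k; case/mxvec_indexP: k => i j.
  have := g0 i j; rewrite /= in_itv /= => gij; move: (gij); rewrite mxE => -> /=.
  have <- : vec_mx v i j = v ord0 (mxvec_index i j) by rewrite mxE.
  apply: (@le_trans _ _ (weight X i)).
    by rewrite -(ga i) (bigD1 j) //= lerDl sumr_ge0.
  by rewrite -(weight_sum1 X) (bigD1 i) //= lerDl sumr_ge0 // => *; exact: weight_ge0.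
have cf : continuous f.
  have cW : continuous (fun v => cost_W X Y (vec_mx v)).
    by do 2!apply: (cS _ _) => ?; apply: (cM _ _).
  have cGW : continuous (fun v => cost_GW X Y (vec_mx v)).
    by do 4!apply: (cS _ _) => ?; apply: (cM _ _) => //; apply: (cM _ _).
  by move=> v; exact: (cvgD (cM _ _ (cC _) cW v) (cM _ _ (cC _) cGW v)).
have [v /set_mem Av minv] := EVT_min_rV A0 cA (continuous_subspaceT cf).
exists (vec_mx v); split=> // g Ug; rewrite -[g in leRHS]mxvecK.
by apply: minv; apply/mem_set; rewrite /A /= mxvecK.
Qed.

Lemma FGW2_attained (R : realType) (d n m : nat) (alpha : R)
    (X : network R d n) (Y : network R d m) :
  exists2 gamma, FGW_optimal alpha X Y gamma &
    FGW2 alpha X Y = cost_FGW alpha X Y gamma.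
Proof.
have [g og] := FGW_optimal_exists alpha X Y.
by exists g => //; exact: FGW_optimalE.
Qed.

(* Main.v *)
(** Disintegrate [gamma = diag a *m P] with [P] row-stochastic.  Any coupling
    [sigma] of [X] with the projection [T] induces the coupling [sigma *m P] of
    [X] with [Y], and since [T] consists of the [P]-means of [Y], the
    bias-variance decomposition gives
    [cost X Y (sigma *m P) = cost X T sigma + cost T Y gamma] for every [sigma].
    Hence minimality of [gamma] makes [diag a] optimal between [X] and [T], and
    the identity at [sigma = diag a] is the claim. *)

Require Import Defs.
From mathcomp Require Import all_boot all_order all_algebra.
From mathcomp Require Import all_classical all_reals.
From mathcomp Require Import ring.

Set Implicit Arguments.
Unset Strict Implicit.
Unset Printing Implicit Defensive.

Import Order.TTheory GRing.Theory Num.Theory.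

Local Open Scope ring_scope.

(** * Bias-variance decomposition for finite weighted families *)

Lemma weighted_variance (R : comPzRingType) (I : finType) (p f : I -> R) (c : R) :
  \sum_j p j = 1 ->
  \sum_j p j * (c - f j) ^+ 2 =
    (c - \sum_j p j * f j) ^+ 2 +
    \sum_j p j * (\sum_j p j * f j - f j) ^+ 2.
Proof.
move=> p1; set M := \sum_j p j * f j.
(* Used at [e = c] and at the mean [e = M]: the second moments cancel in the difference, which
   leaves [(c - M) ^+ 2]. *)
have expand e : \sum_j p j * (e - f j) ^+ 2 =
    e ^+ 2 - e * M *+ 2 + \sum_j p j * f j ^+ 2.
  rewrite -[e ^+ 2]mul1r -p1 mulr_suml mulr_sumr -sumrMnl -sumrB -big_split /=.
  by apply: eq_bigr => j _; ring.
by rewrite !expand; ring.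
Qed.

(** * Integration against a matrix of weights *)

Section Integral.
Context (R : comPzRingType).

(** A coupling is treated as a measure on index pairs: both transport costs become integrals, single
    or iterated, and disintegration is proved once for all integrands. *)
Definition integral (n m : nat) (g : 'M[R]_(n, m)) (F : 'I_n -> 'I_m -> R) : R :=
  \sum_(i < n) \sum_(j < m) g i j * F i j.

Lemma eq_integral n m (g : 'M[R]_(n, m)) F G :
  (forall i j, F i j = G i j) -> integral g F = integral g G.
Proof. by move=> FG; do 2!(apply: eq_bigr => ? _); rewrite FG. Qed.

Lemma integralD n m (g : 'M[R]_(n, m)) F G :
  integral g (fun i j => F i j + G i j) = integral g F + integral g G.
Proof.
rewrite -big_split; apply: eq_bigr => i _ /=.
by rewrite -big_split; apply: eq_bigr => j _ /=; rewrite mulrDr.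
Qed.

Lemma integral_sumr n m p (g : 'M[R]_(n, m)) (w : 'I_p -> R) F :
  \sum_q w q * integral g (F q) =
  integral g (fun i j => \sum_q w q * F q i j).
Proof.
under eq_bigr do rewrite mulr_sumr; rewrite exchange_big; apply: eq_bigr => i _.
under eq_bigr do rewrite mulr_sumr; rewrite exchange_big; apply: eq_bigr => j _.
by rewrite mulr_sumr; apply: eq_bigr => q _; rewrite mulrCA.
Qed.

(** Fubini with [P] as a kernel: [F i] is averaged over row [k] of [P] before [s] is applied. *)
Lemma integral_mulmx n p m (s : 'M[R]_(n, p)) (P : 'M[R]_(p, m)) F :
  integral (s *m P) F = integral s (fun i k => \sum_j P k j * F i j).
Proof.
apply: eq_bigr => i _; under eq_bigr do rewrite mxE mulr_suml.
rewrite exchange_big; apply: eq_bigr => k _ /=.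
by rewrite mulr_sumr; apply: eq_bigr => j _; rewrite mulrA.
Qed.

Lemma integral_diag n (a : 'rV[R]_n) F :
  integral (diag_mx a) F = \sum_i a 0 i * F i i.
Proof.
apply: eq_bigr => i _; rewrite (bigD1 i) //= mxE eqxx big1 ?addr0 // => j ji.
by rewrite mxE eq_sym (negbTE ji) mul0r.
Qed.

Lemma integral_snd n p (s : 'M[R]_(n, p)) (b F : 'I_p -> R) :
  (forall k, \sum_i s i k = b k) ->
  integral s (fun _ k => F k) = \sum_k b k * F k.
Proof.
move=> sb; rewrite /integral exchange_big; apply: eq_bigr => k _.
by rewrite -sb mulr_suml.
Qed.

End Integral.

(** * The transport costs as integrals *)

Section Costs.
Context (R : realType) (d n m : nat) (X : network R d n) (Y : network R d m).

Lemma cost_WE (g : 'M[R]_(n, m)) :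
  cost_W X Y g =
  integral g (fun i j => \sum_c (node X i ord0 c - node Y j ord0 c) ^+ 2).
Proof.
do 2!(apply: eq_bigr => ? _); rewrite sqr_sqrtr; last first.
  by apply: sumr_ge0 => c _; exact: sqr_ge0.
by congr (_ * _); apply: eq_bigr => c _; rewrite !mxE.
Qed.

(** The iterated form keeps the two copies of [g] apart, so that each can be disintegrated on its
    own. *)
Lemma cost_GWE (g : 'M[R]_(n, m)) :
  cost_GW X Y g =
  integral g (fun i j => integral g (fun k l =>
    (omega X i k - omega Y j l) ^+ 2)).
Proof.
do 2!(apply: eq_bigr => ? _); rewrite mulr_sumr; apply: eq_bigr => k _.
by rewrite mulr_sumr; apply: eq_bigr => l _; rewrite mulrA.
Qed.

End Costs.

(** * Gluing couplings along the barycentric projection *)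

Section Projection.
Context (R : realType) (d n m : nat) (X : network R d n) (Y : network R d m).
Context (gamma : 'M[R]_(n, m)).
Hypothesis weight_gt0 : forall i, 0 < weight X i.
Hypothesis Ugamma : couplings (weight X) (weight Y) gamma.

Let T := barycentric_projection X Y gamma.
Let P : 'M[R]_(n, m) := \matrix_(i, j) (gamma i j / weight X i).
Let D : 'M[R]_n := diag_mx (\row_i weight X i).

Lemma kernel_sum1 i : \sum_j P i j = 1.
Proof.
case: Ugamma => _ _ ga; under eq_bigr do rewrite mxE.
by rewrite -mulr_suml ga divff // gt_eqF.
Qed.

Lemma diag_kernel : D *m P = gamma.
Proof.
by apply/matrixP => i j; rewrite mul_diag_mx !mxE mulrC divfK // gt_eqF.
Qed.

Lemma diag_coupling : couplings (weight X) (weight T) D.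
Proof.
split=> [i j|j|i]; first by rewrite !mxE mulrn_wge0 // ltW.
- rewrite (bigD1 j) //= big1 => [|i ij]; first by rewrite !mxE eqxx addr0.
  by rewrite !mxE (negbTE ij).
- rewrite (bigD1 i) //= big1 => [|j ij]; first by rewrite !mxE eqxx addr0.
  by rewrite !mxE eq_sym (negbTE ij).
Qed.

Lemma glue_coupling sigma :
  couplings (weight X) (weight T) sigma ->
  couplings (weight X) (weight Y) (sigma *m P).
Proof.
case: (Ugamma) => g0 gb _ [s0 sT sX]; split=> [i j|j|i].
- rewrite mxE; apply: sumr_ge0 => k _.
  by rewrite mxE mulr_ge0 // divr_ge0 // ltW.
(* Once [gamma] is written as [D *m P], only column sums of the left factors matter, and [sigma] and
   [D] share these. *)
- rewrite -gb -diag_kernel; under eq_bigr do rewrite mxE.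
  under [RHS]eq_bigr do rewrite mxE; rewrite exchange_big [RHS]exchange_big /=.
  case: diag_coupling => _ DT _; apply: eq_bigr => k _.
  by rewrite -!mulr_suml sT DT.
- under eq_bigr do rewrite mxE; rewrite exchange_big -sX; apply: eq_bigr => k _.
  by rewrite -mulr_sumr kernel_sum1 mulr1.
Qed.

(** The squared Euclidean distance splits over coordinates, and the scalar decomposition applies to
    each coordinate [c]. *)
Lemma barycentric_node_variance (x : 'rV[R]_d) k :
  \sum_j P k j * (\sum_c (x ord0 c - node Y j ord0 c) ^+ 2) =
  \sum_c (x ord0 c - node T k ord0 c) ^+ 2 +
  \sum_j P k j * (\sum_c (node T k ord0 c - node Y j ord0 c) ^+ 2).
Proof.
under eq_bigr do rewrite mulr_sumr.
under [X in _ = _ + X]eq_bigr do rewrite mulr_sumr.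
rewrite exchange_big [X in _ = _ + X]exchange_big -big_split /=.
apply: eq_bigr => c _.
have -> : node T k ord0 c = \sum_j P k j * node Y j ord0 c.
  by rewrite summxE; apply: eq_bigr => j _; rewrite !mxE.
by apply: weighted_variance; exact: kernel_sum1.
Qed.

(** [omega T k k'] is the mean of [omega Y] under the product of rows [k] and [k'] of [P], so the
    scalar decomposition applies on index pairs. *)
Lemma barycentric_omega_variance (w : R) k k' :
  \sum_j P k j * (\sum_l P k' l * (w - omega Y j l) ^+ 2) =
  (w - omega T k k') ^+ 2 +
  \sum_j P k j * (\sum_l P k' l * (omega T k k' - omega Y j l) ^+ 2).
Proof.
have pairE (F : 'I_m -> 'I_m -> R) :
    \sum_j P k j * (\sum_l P k' l * F j l) =
    \sum_q P k q.1 * P k' q.2 * F q.1 q.2.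
  rewrite -(pair_bigA _ (fun j l => P k j * P k' l * F j l)).
  apply: eq_bigr => j _; rewrite mulr_sumr.
  by apply: eq_bigr => l _; rewrite mulrA.
have -> : omega T k k' = \sum_q P k q.1 * P k' q.2 * omega Y q.1 q.2.
  rewrite -pairE; apply: eq_bigr => j _; rewrite mulr_sumr.
  by apply: eq_bigr => l _; rewrite [RHS]mulrA !mxE.
rewrite !pairE; apply: weighted_variance.
rewrite -(pair_bigA _ (fun j l => P k j * P k' l)) -(kernel_sum1 k) /=.
by apply: eq_bigr => j _; rewrite -mulr_sumr kernel_sum1 mulr1.
Qed.

(** The variance term depends on [k] alone, so its integral sees only the second marginal of
    [sigma]. That marginal is also the one of [D], for which the integral is [cost_W T Y gamma]. *)
Lemma cost_W_glue sigma : couplings (weight X) (weight T) sigma ->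
  cost_W X Y (sigma *m P) = cost_W X T sigma + cost_W T Y gamma.
Proof.
case=> _ sT _; rewrite !cost_WE integral_mulmx.
under eq_integral do rewrite barycentric_node_variance.
rewrite integralD (integral_snd _ sT) -diag_kernel integral_mulmx integral_diag.
by congr (_ + _); apply: eq_bigr => k _; rewrite mxE.
Qed.

Lemma cost_GW_glue sigma : couplings (weight X) (weight T) sigma ->
  cost_GW X Y (sigma *m P) = cost_GW X T sigma + cost_GW T Y gamma.
Proof.
case=> _ sT _.
have glue (s : 'M[R]_n) (F : 'I_n -> 'I_n -> 'I_m -> 'I_m -> R) :
    integral (s *m P) (fun i j => integral (s *m P) (fun i' l => F i i' j l)) =
    integral s (fun i k => integral s (fun i' k' =>
      \sum_j P k j * (\sum_l P k' l * F i i' j l))).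
  rewrite integral_mulmx; apply: eq_integral => i k.
  by under eq_bigr do rewrite integral_mulmx; rewrite integral_sumr.
(* The variance term now depends on [k] and [k'] only, so each of the two integrals reduces to the
   second marginal. *)
have margin (s : 'M[R]_n) (V : 'I_n -> 'I_n -> R) :
    (forall k, \sum_i s i k = weight T k) ->
    integral s (fun _ k => integral s (fun _ k' => V k k')) =
    \sum_k weight T k * \sum_k' weight T k' * V k k'.
  move=> sb; rewrite (integral_snd _ sb); apply: eq_bigr => k _.
  by rewrite (integral_snd _ sb).
rewrite !cost_GWE -diag_kernel !glue.
under eq_integral => i k.
  under eq_integral do rewrite barycentric_omega_variance.
  rewrite integralD; over.
rewrite integralD (margin _ _ sT) integral_diag; congr (_ + _).
apply: eq_bigr => k _; rewrite integral_diag mxE; congr (_ * _).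
by apply: eq_bigr => k' _; rewrite mxE.
Qed.

Lemma cost_FGW_glue alpha sigma : couplings (weight X) (weight T) sigma ->
  cost_FGW alpha X Y (sigma *m P) =
  cost_FGW alpha X T sigma + cost_FGW alpha T Y gamma.
Proof.
by move=> Us; rewrite /cost_FGW cost_W_glue // cost_GW_glue //; ring.
Qed.

(** Adding the constant [cost_FGW alpha T Y gamma] to both sides turns the comparison of [D] with
    [sigma] into that of [gamma] with [sigma *m P]. *)
Lemma diag_optimal alpha :
  FGW_optimal alpha X Y gamma -> FGW_optimal alpha X T D.
Proof.
case=> _ ming; split=> [|sigma Us]; first exact: diag_coupling.
rewrite -(lerD2r (cost_FGW alpha T Y gamma)) -!cost_FGW_glue //.
  by rewrite diag_kernel; apply: ming; exact: glue_coupling.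
exact: diag_coupling.
Qed.

Lemma FGW2_barycentric_projection alpha : FGW_optimal alpha X Y gamma ->
  FGW2 alpha X Y = FGW2 alpha X T + cost_FGW alpha T Y gamma.
Proof.
move=> og; rewrite (FGW_optimalE og) (FGW_optimalE (diag_optimal og)).
by rewrite -cost_FGW_glue ?diag_kernel //; exact: diag_coupling.
Qed.

End Projection.

Theorem corollary1 (R : realType) (d n : nat) (X : network R d n)
    (alpha : R) (weight_gt0 : forall i, 0 < weight X i)
    (alpha01 : 0 <= alpha <= 1) :
  (forall (m : nat) (Y : network R d m) (gamma : 'M[R]_(n, m)),
     FGW_optimal alpha X Y gamma ->
     FGW2 alpha X Y =
       FGW2 alpha X (barycentric_projection X Y gamma) +
       cost_FGW alpha (barycentric_projection X Y gamma) Y gamma) /\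
  (forall (N : nat) (m : 'I_N -> nat) (Y : forall l, network R d (m l))
          (gamma : forall l, 'M[R]_(n, m l)),
     (0 < N)%N ->
     (forall l, FGW_optimal alpha X (Y l) (gamma l)) ->
     N%:R^-1 * (\sum_(l < N) FGW2 alpha X (Y l)) =
       N%:R^-1 * (\sum_(l < N)
         FGW2 alpha X (barycentric_projection X (Y l) (gamma l))) +
       N%:R^-1 * (\sum_(l < N)
         cost_FGW alpha (barycentric_projection X (Y l) (gamma l))
           (Y l) (gamma l))).
Proof.
have step m (Y : network R d m) gamma (og : FGW_optimal alpha X Y gamma) :=
  FGW2_barycentric_projection weight_gt0 og.1 og.
split=> [//|N m Y gamma _ og].
by rewrite -mulrDr -big_split; congr (_ * _); apply: eq_bigr => l _; exact: step.
Qed.
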